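(* Let $2<p<\infty$ and $n\in\mathbb N$. Let $\{x_i\}_{i\in\mathbb N}$ be a sequence of independent mean zero random variables in $L^p[0,1]$ with $\|x_i\|_p=1$ for each $i$, and let $w_i=\|x_i\|_2$. Then there are positive constants $K_1,K_2$ such that for all families of scalars $(a_{i_1,\ldots,i_n})_{i_1,\ldots,i_n\in\mathbb N}$ with only finitely many nonzero terms, the quantities $$A=\Big\|\sum_{i_1,\ldots,i_n}a_{i_1,\ldots,i_n}\,(x_{i_1}\otimes\cdots\otimes x_{i_n})\Big\|_{L^p([0,1]^n)}$$ and $$B=\max_{S\subset\{1,\ldots,n\}}\left\{\Bigg(\sum_{i_k:\,k\in S}\Big(\sum_{i_\ell:\,\ell\in S^c}|a_{i_1,\ldots,i_n}|^2\prod_{\ell\in S^c}w_{i_\ell}^2\Big)^{p/2}\Bigg)^{1/p}\right\}$$ satisfy $A\le K_1B$ and $B\le K_2A$, where the maximum is over all subsets $S$ of $\{1,\ldots,n\}$ and $S^c=\{1,\ldots,n\}\setminus S$.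
   Context: $x_{i_1}\otimes\cdots\otimes x_{i_n}$ denotes the function $(t_1,\ldots,t_n)\mapsto x_{i_1}(t_1)\cdots x_{i_n}(t_n)$ on $[0,1]^n$. Random variables are measurable functions on the probability space $[0,1]$ with Lebesgue measure. In the expression $B$, the outer sum is over all values in $\mathbb N$ of the indices $i_k$ with $k\in S$ and the inner sum is over all values in $\mathbb N$ of the indices $i_\ell$ with $\ell\in S^c$; a sum over an empty set of indices consists of its single summand, and an empty product is $1$. *)

(* Defs.v *)
From HB Require Import structures.
From mathcomp Require Import all_boot all_order all_algebra.
From mathcomp Require Import all_classical all_reals all_analysis.

Set Implicit Arguments.
Unset Strict Implicit.
Unset Printing Implicit Defensive.

Import Order.TTheory GRing.Theory Num.Theory.
Import numFieldNormedType.Exports.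

Local Open Scope classical_set_scope.
Local Open Scope ring_scope.

Definition unit_interval (R : realType) := {t : R | t \in `[0, 1]}.

Section unit_interval.
Context {R : realType}.
Implicit Types A : set (unit_interval R).

HB.instance Definition _ := SubType.on (unit_interval R).
HB.instance Definition _ := Choice.on (unit_interval R).

Let zero_in01 : (0 : R) \in `[0, 1]. Proof. by rewrite in_itv/= lexx ler01. Qed.

HB.instance Definition _ :=
  isPointed.Build (unit_interval R) (exist _ 0 zero_in01).

(* Borel sets of [0, 1] = traces on [0, 1] of the Borel sets of R. *)
Let inclusion : unit_interval R -> measurableTypeR R := \val.

HB.instance Definition _ := Measurable.copy (unit_interval R)
  (g_sigma_algebra_preimageType inclusion).

Lemma measurable_unit_intervalP A : measurable A <->
  exists2 B : set R, measurable B & A = \val @^-1` B.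
Proof.
by split=> -[B mB AB]; exists B => //; move: AB; rewrite setTI.
Qed.

Lemma measurable_val_unit_interval :
  measurable_fun setT (\val : unit_interval R -> R).
Proof.
by move=> _ B mB; rewrite setTI; apply/measurable_unit_intervalP; exists B.
Qed.

Lemma image_val_preimage (B : set R) :
  \val @` ((\val : unit_interval R -> R) @^-1` B) = B `&` `[0, 1].
Proof.
apply/seteqP; split=> [_ [t Bt <-]|x [Bx x01]].
  by split=> //; exact: (valP t).
by exists (exist _ x x01).
Qed.

Lemma measurable_image_val A : measurable A ->
  measurable (\val @` A : set R).
Proof.
move=> /measurable_unit_intervalP[B mB ->]; rewrite image_val_preimage.
by apply: measurableI.
Qed.

(* Lebesgue measure on [0, 1]: the measure of A is the Lebesgue measure of A
   seen as a subset of R. *)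
Definition lebesgue01 A : \bar R := lebesgue_measure (\val @` A : set R).

Let lebesgue01_set0 : lebesgue01 set0 = 0%E.
Proof. by rewrite /lebesgue01 image_set0 measure0. Qed.

Let lebesgue01_ge0 A : (0 <= lebesgue01 A)%E.
Proof. exact: measure_ge0. Qed.

Let lebesgue01_sigma_additive : semi_sigma_additive lebesgue01.
Proof.
move=> F mF tF mUF; rewrite /lebesgue01 image_bigcup.
apply: measure_semi_sigma_additive.
- by move=> i; exact: measurable_image_val.
- apply/trivIsetP => i j _ _ ij.
  rewrite -subset0 => _ [[s Fis <-] [t Fjt /val_inj ts]].
  have : (F i `&` F j) s by split; rewrite // -ts.
  by move/trivIsetP : tF => ->.
- by rewrite -image_bigcup; exact: measurable_image_val.
Qed.

HB.instance Definition _ := isMeasure.Build _ _ _ lebesgue01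
  lebesgue01_set0 lebesgue01_ge0 lebesgue01_sigma_additive.

Let lebesgue01_setT : lebesgue01 setT = 1%E.
Proof.
rewrite /lebesgue01 -(preimage_setT (\val : unit_interval R -> R)).
rewrite image_val_preimage setTI lebesgue_measure_itv/= lte_fin ltr01.
by rewrite oppr0 adde0.
Qed.

HB.instance Definition _ :=
  Measure_isProbability.Build _ _ _ lebesgue01 lebesgue01_setT.

End unit_interval.

Section power_probability.
Context d (T : measurableType d) (R : realType).

Definition cons_pair n (u : T * n.-tuple T) : n.+1.-tuple T :=
  [tuple of u.1 :: u.2].

Lemma measurable_cons_pair n : measurable_fun setT (@cons_pair n).
Proof. exact: measurable_cons. Qed.

HB.instance Definition _ n :=
  isMeasurableFun.Build _ _ _ _ (@cons_pair n) (@measurable_cons_pair n).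

(* The n-fold product of P with itself; the distribution of cons_pair
   transports the product measure from T * m.-tuple T to m.+1.-tuple T. *)
Fixpoint power_probability (P : probability T R) n :
    probability (n.-tuple T) R :=
  if n is m.+1 then distribution (P \x power_probability P m)%E (@cons_pair m)
  else dirac [tuple].

End power_probability.

Section independence.
Context d (T : measurableType d) (R : realType) (P : probability T R).

Definition independent_sequence (x : nat -> T -> R) : Prop :=
  forall (J : seq nat) (E : nat -> set R), uniq J ->
    (forall i, measurable (E i)) ->
    P (\big[setI/setT]_(i <- J) (x i @^-1` E i)) =
    (\prod_(i <- J) P (x i @^-1` E i))%E.

End independence.

Section tensor_and_norm.
Context (R : realType).

Definition tensor (T : Type) (x : nat -> T -> R) n (i : n.-tuple nat)
    (t : n.-tuple T) : R :=
  \prod_(k < n) x (tnth i k) (tnth t k).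

Definition tensor_sum (T : Type) (x : nat -> T -> R) n (a : n.-tuple nat -> R)
    (t : n.-tuple T) : R :=
  \sum_(i \in [set: n.-tuple nat]) a i * tensor x i t.

(* A choice j of the indices i_k, k \in S, is encoded by the multi-index that
   extends it by 0 outside S. *)
Definition outer_indices n (S : {set 'I_n}) : set (n.-tuple nat) :=
  [set j | forall k, k \notin S -> tnth j k = 0%N].

(* The multi-indices whose components in S are those of j; the components
   outside S are free. *)
Definition inner_indices n (S : {set 'I_n}) (j : n.-tuple nat) :
    set (n.-tuple nat) :=
  [set i | forall k, k \in S -> tnth i k = tnth j k].

Definition mixed_norm (p : R) (w : nat -> R) n (a : n.-tuple nat -> R)
    (S : {set 'I_n}) : R :=
  (\sum_(j \in outer_indices S)
     (\sum_(i \in inner_indices S j)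
        `|a i| ^+ 2 * \prod_(l in ~: S) w (tnth i l) ^+ 2) `^ (p / 2)) `^ p^-1.

(* The mixed norms are nonnegative, so starting the maximum at 0 is harmless. *)
Definition max_mixed_norm (p : R) (w : nat -> R) n (a : n.-tuple nat -> R) : R :=
  \big[Num.max/0]_(S : {set 'I_n}) mixed_norm p w a S.

End tensor_and_norm.

(* Main.v *)
From HB Require Import structures.
Require Import Defs.
From mathcomp Require Import all_boot all_order all_algebra.
From mathcomp Require Import all_classical all_reals all_analysis.
From mathcomp Require Import measurable_realfun.
From mathcomp Require Import ring lra.

Set Implicit Arguments.
Unset Strict Implicit.
Unset Printing Implicit Defensive.

Import Order.TTheory GRing.Theory Num.Theory.
Import numFieldNormedType.Exports.

Local Open Scope classical_set_scope.
Local Open Scope ring_scope.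

(** Put [q = p / 2].  The estimate is proved for coefficients [a] with values
    in a finite-dimensional Hilbert space [R^M], for the quantity
    [I_n(a) = \int (\sum_m (\sum_i a i m * x_i(t))^2)^q dt], and with constants
    that do not depend on [M].  Carrying the dimension [M] along is what makes
    the induction on the number [n] of tensor factors close.

    Fix all the variables but the first, [t_1].  The integral over [t_1] is the
    [p]-th moment of [\sum_i c_i x_i(t_1)], where the vectors [c_i] depend on
    the other variables, and Rosenthal's inequality in [R^M] (lemma [rosenthal])
    says that it is comparable to
    [\sum_i |c_i|^p + (\sum_i w_i^2 |c_i|^2)^q].
    Integrating over the other variables, each summand of the first sum becomes
    an integral [I_(n-1)] for the coefficients with their first index fixed; the
    second term becomes [I_(n-1)] for coefficients with values in the larger
    space [R^(I * M)], whose first index has turned into a coordinate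
    ([tensor_moment_step]).  The mixed norms of [a] obey the same recursion
    ([total_power_cons]): the sets [S] that contain the first index correspond
    to the first term, the others to the second one.

    Rosenthal's inequality comes from two pointwise inequalities in a Hilbert
    space, valid for [p > 2]:
    [|u + v|^p >= |u|^p + p |u|^(p-2) <u, v> + c |v|^p] and
    [|u + v|^p <= |u|^p + p |u|^(p-2) <u, v> + C (|u|^(p-2) |v|^2 + |v|^p)]
    ([powR_uniform_convexity], [exists_smoothness_constant]; both are written in
    terms of [A = |u|^2], [B = |v|^2] and [s = <u, v>], with [s^2 <= A B]).
    Take for [u] the partial sum [S_k] and for [v] the next term [x_k c_k].  As
    [x_k] is centred and independent of [S_k], the linear term disappears.  The
    first inequality makes the moments [E|S_k|^p] nondecreasing in [k] and
    bounds [\sum_i |c_i|^p] by the last one.  Summing the second one bounds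
    [J = E|S_N|^p] in terms of [V = \sum_i w_i^2 |c_i|^2], of
    [\sum_i |c_i|^p] and of the moments of order [p - 2], which split as
    [|u|^(p-2) <= s^(q-1) + |u|^p / s] (with [s] in the role of a squared
    radius); for [s] a suitable multiple of [V] the resulting multiple of [J]
    can be absorbed in the left-hand side ([self_bound]).  Finally
    [V = E|S_N|^2] is at most a multiple of [J^(1/q)] by a similar splitting.

    Independence enters through Tonelli's theorem: a nonnegative function of
    the past [x_0, ..., x_(k-1)] and of [x_k] has the same integral when [x_k]
    is evaluated at an independent point ([integral_decouple]).  Thus no
    integrability has to be checked for mixed terms. *)

(** * Real powers *)

Section powR_inequalities.
Context {R : realType}.
Implicit Types q r x y A B s : R.

(** Convexity of [x^q], read off Young's inequality for [x^(q-1) * y] with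
    exponents [q / (q - 1)] and [q]. *)
Lemma powR_tangent q x y : 1 < q -> 0 <= x -> 0 <= y ->
  x `^ q + q * x `^ (q - 1) * (y - x) <= y `^ q.
Proof.
move=> q1 x0 y0.
have q0 : 0 < q by lra.
have r0 : 0 < q - 1 by lra.
have qn0 : q != 0 by rewrite gt_eqF.
have rn0 : q - 1 != 0 by rewrite gt_eqF.
have conj : (q / (q - 1))^-1 + q^-1 = 1 by field; rewrite qn0 rn0.
have := conjugate_powR (powR_ge0 x (q - 1)) y0 (divr_gt0 q0 r0) q0 conj.
rewrite -powRrM mulrCA divff// mulr1.
rewrite -(ler_pM2r q0) mulrDl divfK// invf_div mulrA divfK// => young.
have := mulr_powRB1 x0 q0.
move: (x `^ q) (x `^ (q - 1)) (y `^ q) young => u v w young e; subst u.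
lra.
Qed.

Lemma powR_superadditive q x y : 1 < q -> 0 <= x -> 0 <= y ->
  x `^ q + y `^ q <= (x + y) `^ q.
Proof.
move=> q1 x0 y0; have q0 : 0 < q by lra.
rewrite -(mulr_powRB1 x0 q0) -(mulr_powRB1 y0 q0).
rewrite -(mulr_powRB1 (addr_ge0 x0 y0) q0) mulrDl.
by apply: lerD; apply: ler_wpM2l => //; apply: ge0_ler_powR;
  rewrite ?nnegrE ?lerDl ?lerDr//; lra.
Qed.

(** Sum of the tangent inequalities at the midpoint, whose linear terms
    cancel. *)
Lemma powR_midpoint q x y : 1 < q -> 0 <= x -> 0 <= y ->
  2 * ((x + y) / 2) `^ q <= x `^ q + y `^ q.
Proof.
move=> q1 x0 y0.
have m0 : 0 <= (x + y) / 2 by lra.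
have := powR_tangent q1 m0 x0; have := powR_tangent q1 m0 y0.
set u := _ `^ (q - 1); set v := _ `^ q; set w := _ `^ q; set t := _ `^ q.
move=> h1 h2.
have : 2 * v + q * u * ((x + y) - 2 * ((x + y) / 2)) <= t + w by lra.
rewrite (_ : x + y - _ = 0); last by lra.
by rewrite mulr0 addr0.
Qed.

Lemma powR_subadditive2 r x y : 0 <= r -> 0 <= x -> 0 <= y ->
  (x + y) `^ r <= 2 `^ r * (x `^ r + y `^ r).
Proof.
move=> r0; wlog xy : x y / x <= y.
  move=> h x0 y0; case/orP: (le_total x y) => xy; first exact: h.
  by rewrite addrC [X in _ * X]addrC; exact: h.
move=> x0 y0; apply: (@le_trans _ _ ((2 * y) `^ r)).
  by apply: ge0_ler_powR; rewrite ?nnegrE; lra.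
by rewrite powRM//; apply: ler_wpM2l; rewrite ?powR_ge0// lerDr powR_ge0.
Qed.

(** The function [x^r / x] is nonincreasing, in a form without division. *)
Lemma powR_ratio_le r x y : 0 < r <= 1 -> 0 <= x -> x <= y ->
  y `^ r * x <= y * x `^ r.
Proof.
move=> /andP[r0 r1]; rewrite le_eqVlt => /predU1P[<-|x0] xy.
  by rewrite mulr0 powR0 ?gt_eqF// mulr0.
have y0 : 0 < y by lra.
have split_ z : 0 < z -> z = z `^ r * z `^ (1 - r).
  by move=> z0; rewrite -powRD ?subrKC ?oner_eq0// powRr1// ltW.
rewrite [X in _ * X <= _](split_ x)// [X in _ <= X * _](split_ y)//.
rewrite mulrA -[leRHS]mulrA [X in _ <= _ * X]mulrC [leRHS]mulrA.
apply: ler_wpM2l; first by rewrite mulr_ge0 ?powR_ge0.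
by apply: ge0_ler_powR; rewrite ?nnegrE; lra.
Qed.

(** For [r <= 1] the chords from the origin control both powers; for [r > 1] the
    tangent at [D + h] does.  The factor [D] on the left, rather than [D^(r-1)]
    on the right, avoids a negative power at [D = 0]. *)
Lemma powR_symmetric_difference r D h : 0 < r -> 0 <= h -> h <= D ->
  ((D + h) `^ r - (D - h) `^ r) * D <= (2 + r * 2 `^ r) * (h * D `^ r).
Proof.
move=> r0 h0 hD; have D0 : 0 <= D by lra.
have hDr : 0 <= h * D `^ r by rewrite mulr_ge0 ?powR_ge0.
have [r1|r1] := leP r 1.
  have r01 : 0 < r <= 1 by rewrite r0.
  have Dh : D <= D + h by lra.
  have hD' : D - h <= D by lra.
  have hD0 : 0 <= D - h by lra.
  have := powR_ratio_le r01 D0 Dh; have := powR_ratio_le r01 hD0 hD'.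
  have : 0 <= r * 2 `^ r * (h * D `^ r) by rewrite !mulr_ge0 ?powR_ge0// ltW.
  move: hDr; move: (D `^ r) (2 `^ r) (_ `^ r) (_ `^ r) => u v w t; nra.
have X0 : 0 <= D + h by lra.
have Z0 : 0 <= D - h by lra.
have tan := powR_tangent r1 X0 Z0.
have X2 : (D + h) `^ (r - 1) * (2 * D) <= 2 `^ r * D `^ r.
  apply: (@le_trans _ _ ((2 * D) `^ (r - 1) * (2 * D))).
    apply: ler_wpM2r; first by lra.
    by apply: ge0_ler_powR; rewrite ?nnegrE; lra.
  by rewrite mulrC mulr_powRB1 ?powRM//; lra.
apply: (@le_trans _ _ (r * (D + h) `^ (r - 1) * (2 * h) * D)).
  by apply: ler_wpM2r => //; lra.
have := ler_wpM2l (mulr_ge0 (ltW r0) h0) X2.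
by move: hDr; move: (D `^ r) (2 `^ r) (_ `^ _) => u v w; nra.
Qed.

Lemma norm_double_le A B s : 0 <= A -> 0 <= B -> s ^+ 2 <= A * B ->
  `|2 * s| <= A + B.
Proof.
move=> A0 B0 sAB; rewrite -ler_sqr ?nnegrE ?addr_ge0// real_normK ?num_real//.
have := sqr_ge0 (A - B); rewrite !expr2 in sAB *; nra.
Qed.

(** Clarkson's argument, for [A = |u|^2], [B = |v|^2] and [s = <u, v>]:
    go through the midpoint [u + v / 2] of [u] and [u + v]: by the
    parallelogram law
    [|u + v|^2 + |u|^2 = 2 (|u + v / 2|^2 + |v / 2|^2)], so that convexity
    and superadditivity of the [q]-th power give
    [|u + v|^p + |u|^p >= 2 |u + v / 2|^p + 2 |v / 2|^p],
    and the tangent at [u] is used at [u + v / 2] only. *)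
Lemma powR_uniform_convexity q A B s : 1 < q -> 0 <= A -> 0 <= B ->
  s ^+ 2 <= A * B ->
  A `^ q + 2 * q * A `^ (q - 1) * s + 2 * 4^-1 `^ q * B `^ q
  <= (A + 2 * s + B) `^ q.
Proof.
move=> q1 A0 B0 sAB.
have X0 : 0 <= A + 2 * s + B.
  by have := norm_double_le A0 B0 sAB; rewrite ler_norml => /andP[]; lra.
have B40 : 0 <= B / 4 by lra.
have Y0 : 0 <= A + s + B / 4.
  have s2AB : (s / 2) ^+ 2 <= A * (B / 4) by rewrite expr_div_n; lra.
  by have := norm_double_le A0 B40 s2AB; rewrite ler_norml => /andP[]; lra.
have mid := powR_midpoint q1 A0 X0.
have sup := @powR_superadditive q (A + s + B / 4) (B / 4) q1 Y0.
have tan := powR_tangent q1 A0 Y0.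
rewrite (_ : (A + _) / 2 = A + s + B / 4 + B / 4) in mid; last by lra.
have B4 : (B / 4) `^ q = 4^-1 `^ q * B `^ q by rewrite mulrC powRM.
rewrite B4 in sup.
have : 0 <= q * A `^ (q - 1) * (B / 4) by rewrite !mulr_ge0 ?powR_ge0//; lra.
have {}sup := sup B40.
move: sup mid tan; rewrite -[A + s + _ - A]addrA.
move: (A `^ q) (A `^ (q-1)) (_ `^ q) (_ `^ q) (_ `^ q) => a a' b c d; lra.
Qed.

(** The squared norms of [u + v] and [u - v] are [D + h] and [D - h], up to
    order, with [D = |u|^2 + |v|^2] and [h = 2 |<u, v>|].  In the sum of their
    [q]-th powers the terms of first order in [h] cancel, and
    [h^2 <= 4 B D]. *)
Lemma powR_symmetric_sum q A B s : 1 < q -> 0 <= A -> 0 <= B ->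
  s ^+ 2 <= A * B ->
  (A + 2 * s + B) `^ q + (A - 2 * s + B) `^ q <= 2 * A `^ q +
  (2 * q + 4 * q * (2 + (q - 1) * 2 `^ (q - 1))) * ((A + B) `^ (q - 1) * B).
Proof.
move=> q1 A0 B0; wlog s0 : s / 0 <= s => [hw|] sAB.
  have [s0|s0] := leP 0 s; first exact: hw.
  have := hw (- s); rewrite oppr_ge0 sqrrN => /(_ (ltW s0) sAB).
  by rewrite !mulrN opprK addrC.
have := norm_double_le A0 B0 sAB; rewrite ger0_norm; last by lra.
set h := 2 * s; set D := A + B => hD.
have h0 : 0 <= h by rewrite /h; lra.
have D0 : 0 <= D by rewrite /D; lra.
rewrite (_ : A + h + B = D + h); last by rewrite /D; lra.
rewrite (_ : A - h + B = D - h); last by rewrite /D; lra.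
have X0 : 0 <= D + h by lra.
have Z0 : 0 <= D - h by lra.
have r0 : 0 < q - 1 by lra.
(* The tangents at D + h and D - h, both evaluated at D, leave h times the
   difference of the derivatives. *)
have tX := powR_tangent q1 X0 D0; have tZ := powR_tangent q1 Z0 D0.
have tD := powR_tangent q1 D0 A0.
have diff := powR_symmetric_difference r0 h0 hD.
set K := 2 + _ in diff *.
have K0 : 0 <= K by rewrite /K addr_ge0 ?mulr_ge0 ?powR_ge0// ltW.
have key : h * ((D + h) `^ (q - 1) - (D - h) `^ (q - 1)) <=
    4 * K * (D `^ (q - 1) * B).
  have [D00|Dn0] := eqVneq D 0.
    have -> : h = 0 by lra.
    by rewrite mul0r !mulr_ge0 ?powR_ge0.
  have Dpos : 0 < D by rewrite lt_def Dn0.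
  rewrite -(ler_pM2r Dpos) -[X in X <= _]mulrA.
  apply: le_trans (ler_wpM2l h0 diff) _.
  rewrite (_ : h * _ = K * D `^ (q - 1) * h ^+ 2); last by ring.
  rewrite (_ : 4 * K * _ * _ = K * D `^ (q - 1) * (4 * (B * D))); last by ring.
  apply: ler_wpM2l; first by rewrite mulr_ge0 ?powR_ge0.
  rewrite /h exprMn; have := mulr_ge0 B0 B0; rewrite /D; lra.
have q0 : 0 <= q by lra.
move/(ler_wpM2l q0): key; move: tX tZ tD; rewrite /D.
move: (_ `^ q) (_ `^ q) (_ `^ q) (_ `^ q) => a b c d.
move: (_ `^ (q - 1)) (_ `^ (q - 1)) (_ `^ (q - 1)) => a' b' c'.
lra.
Qed.

Definition smoothness_constant q C := forall A B s,
  0 <= A -> 0 <= B -> s ^+ 2 <= A * B ->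
  (A + 2 * s + B) `^ q <=
  A `^ q + 2 * q * A `^ (q - 1) * s + C * (A `^ (q - 1) * B + B `^ q).

(** Convexity at [-v] bounds [|u - v|^p] below by its tangent at [u]; removing
    it from the bound on [|u + v|^p + |u - v|^p] leaves the linear term with
    the right sign. *)
Lemma exists_smoothness_constant q : 1 < q ->
  exists2 C : R, 0 < C & smoothness_constant q C.
Proof.
move=> q1; have q0 : 0 < q by lra.
have r0 : 0 <= q - 1 by lra.
pose K : R := 2 * q + 4 * q * (2 + (q - 1) * 2 `^ (q - 1)).
have K0 : 0 < K.
  rewrite /K ltr_wpDr ?mulr_gt0// !mulr_ge0 ?addr_ge0 ?mulr_ge0 ?powR_ge0//.
  exact: ltW.
exists (K * 2 `^ (q - 1)) => [|A B s A0 B0 sAB].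
  by rewrite mulr_gt0// powR_gt0.
have Z0 : 0 <= A - 2 * s + B.
  by have := norm_double_le A0 B0 sAB; rewrite ler_norml => /andP[]; lra.
have sum := powR_symmetric_sum q1 A0 B0 sAB.
have tan := powR_tangent q1 A0 Z0.
have sub := ler_wpM2r B0 (powR_subadditive2 r0 A0 B0).
have BBq := mulr_powRB1 B0 q0.
rewrite -/K in sum.
have KB : K * ((A + B) `^ (q - 1) * B) <=
    K * 2 `^ (q - 1) * (A `^ (q - 1) * B + B `^ q).
  rewrite -[X in _ <= X]mulrA; apply: ler_wpM2l; first exact: ltW.
  by rewrite -BBq; lra.
have : 0 <= q * A `^ (q - 1) * B by rewrite !mulr_ge0 ?powR_ge0// ltW.
lra.
Qed.

End powR_inequalities.

(** * Vectors with one random coordinate direction *)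

Section finite_dimensional_hilbert.
Context {R : realType} {M : finType}.
Implicit Types u v : M -> R.

Definition sqnorm u : R := \sum_m u m ^+ 2.
Definition inner u v : R := \sum_m u m * v m.

Lemma sqnorm_ge0 u : 0 <= sqnorm u.
Proof. by apply: sumr_ge0 => m _; exact: sqr_ge0. Qed.

Lemma sqnorm_line u v (a b : R) : sqnorm (fun m => a * u m + b * v m) =
  a ^+ 2 * sqnorm u + 2 * (a * b * inner u v) + b ^+ 2 * sqnorm v.
Proof.
rewrite /sqnorm /inner !mulr_sumr -!big_split/=.
by apply: eq_bigr => m _; ring.
Qed.

Lemma sqnorm_addZ u v (c : R) : sqnorm (fun m => u m + c * v m) =
  sqnorm u + 2 * (c * inner u v) + c ^+ 2 * sqnorm v.
Proof.
rewrite -[sqnorm u]mul1r -[c in 2 * (c * _)]mul1r -{1}(expr1n _ 2) -sqnorm_line.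
by apply: eq_bigr => m _; rewrite mul1r.
Qed.

(** The quadratic form [|a u + b v|^2] is nonnegative; it is evaluated at
    [(-B, s)], or at [(s, -A)] when [B = 0]. *)
Lemma cauchy_schwarz u v : inner u v ^+ 2 <= sqnorm u * sqnorm v.
Proof.
set A := sqnorm u; set B := sqnorm v; set s := inner u v.
have quad a b : 0 <= a ^+ 2 * A + 2 * (a * b * s) + b ^+ 2 * B.
  by rewrite -sqnorm_line; exact: sqnorm_ge0.
have A0 : 0 <= A := sqnorm_ge0 u.
have B0 : 0 <= B := sqnorm_ge0 v.
have [B00|Bn0] := eqVneq B 0.
  have [A00|An0] := eqVneq A 0.
    have := quad 1 1; have := quad 1 (-1); rewrite A00 B00 => h1 h2.
    by have -> : s = 0 by lra; rewrite expr0n mulr0.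
  have Apos : 0 < A by rewrite lt_def An0.
  have := quad s (- A) => h; rewrite -(ler_pM2r Apos).
  by rewrite B00 !expr2 in h *; lra.
have Bpos : 0 < B by rewrite lt_def Bn0.
have := quad (- B) s => h; rewrite -(ler_pM2r Bpos).
by rewrite !expr2 in h *; lra.
Qed.

End finite_dimensional_hilbert.

(** Here [f] is one of the independent variables and [u] a fixed value of the
    sum of the preceding terms: the integrals are conditional expectations given
    the past. *)
Section one_random_coefficient.
Local Open Scope ereal_scope.
Context d (T : measurableType d) {R : realType} (P : probability T R).
Variables (q W : R) (f : T -> R).
Hypotheses (q1 : (1 < q)%R) (mf : measurable_fun setT f).
Hypothesis f_mean : \int[P]_t (f t)%:E = 0.
Hypothesis f_sq : \int[P]_t (f t ^+ 2)%:E = W%:E.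
Hypothesis f_pow : \int[P]_t ((f t ^+ 2) `^ q)%:E = 1.
Hypothesis f_int : P.-integrable setT (EFin \o f).

Let mf2 : measurable_fun setT (fun t => f t ^+ 2)%R.
Proof. exact: measurable_funX. Qed.

Let mfq : measurable_fun setT (fun t => (f t ^+ 2) `^ q)%R.
Proof. exact: (measurableT_comp (measurable_powR _)). Qed.

Let if2 : P.-integrable setT (EFin \o (fun t => f t ^+ 2)%R).
Proof.
apply/integrableP; split; first exact/measurable_EFinP.
under eq_integral do rewrite /= ger0_norm ?sqr_ge0//.
by rewrite f_sq ltry.
Qed.

Let ifq : P.-integrable setT (EFin \o (fun t => (f t ^+ 2) `^ q)%R).
Proof.
apply/integrableP; split; first exact/measurable_EFinP.
under eq_integral do rewrite /= ger0_norm ?powR_ge0//.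
by rewrite f_pow ltry.
Qed.

(* The pointwise inequalities compare the p-th power with functions of this
   form. *)
Let g (a b c e : R) t := (a + b * f t + c * f t ^+ 2 + e * (f t ^+ 2) `^ q)%R.

Let icst (a : R) : P.-integrable setT (EFin \o cst a).
Proof. exact: finite_measure_integrable_cst. Qed.

Let int_g a b c e : P.-integrable setT (EFin \o g a b c e) /\
  \int[P]_t (g a b c e t)%:E = (a + c * W + e)%:E.
Proof.
have i2 : P.-integrable setT (fun t => b%:E * (f t)%:E) by exact: integrableZl.
have i3 : P.-integrable setT (fun t => c%:E * (f t ^+ 2)%:E).
  exact: integrableZl.
have i4 : P.-integrable setT (fun t => e%:E * ((f t ^+ 2) `^ q)%:E).
  exact: integrableZl.
have i12 := integrableD measurableT (icst a) i2.
have i123 := integrableD measurableT i12 i3.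
have i1234 := integrableD measurableT i123 i4.
have gE : EFin \o g a b c e = (fun t => (cst a t)%:E + b%:E * (f t)%:E +
    c%:E * (f t ^+ 2)%:E + e%:E * ((f t ^+ 2) `^ q)%:E).
  by apply/funext => t; rewrite /g/= !EFinD !EFinM.
split; first by rewrite gE.
rewrite -[LHS]/(\int[P]_t ((EFin \o g a b c e) t)) gE.
rewrite (integralD measurableT i123 i4) (integralD measurableT i12 i3).
rewrite (integralD measurableT (icst a) i2) !integralZl//.
rewrite f_mean f_sq f_pow mule0 adde0 mule1.
have -> : \int[P]_x (EFin \o cst a) x = a%:E.
  rewrite -[LHS]/(\int[P]_x (cst a%:E x)) integral_cst//=.
  by rewrite probability_setT mule1.
by rewrite -EFinM -!EFinD.
Qed.

Context {M : finType}.
Implicit Types u v : M -> R.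

Let F u v t := (sqnorm (fun m => u m + f t * v m) `^ q)%R.

Lemma measurable_sqnorm_random u v :
  measurable_fun setT (fun t => sqnorm (fun m => u m + f t * v m))%R.
Proof.
apply: measurable_sum => m; apply: measurable_funX.
by apply: measurable_funD => //; exact: measurable_funM.
Qed.

Let mF u v : measurable_fun setT (EFin \o F u v).
Proof.
apply/measurable_EFinP; apply: (measurableT_comp (measurable_powR _)).
exact: measurable_sqnorm_random.
Qed.

Lemma integral_sqnorm_random u v :
  \int[P]_t (sqnorm (fun m => u m + f t * v m)%R)%:E =
  (sqnorm u + W * sqnorm v)%:E.
Proof.
rewrite (eq_integral
  (fun t => (g (sqnorm u) (2 * inner u v) (sqnorm v) 0 t)%:E)).
  by rewrite (int_g _ _ _ _).2 addr0 [(W * _)%R]mulrC.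
by move=> t _; rewrite sqnorm_addZ /g; congr EFin; ring.
Qed.

Let cs u v t : ((f t * inner u v) ^+ 2 <= sqnorm u * (f t ^+ 2 * sqnorm v))%R.
Proof.
rewrite exprMn [leRHS]mulrCA; apply: ler_wpM2l; first exact: sqr_ge0.
exact: cauchy_schwarz.
Qed.

Let f2B v t : (0 <= f t ^+ 2 * sqnorm v)%R.
Proof. by rewrite mulr_ge0 ?sqr_ge0 ?sqnorm_ge0. Qed.

Let FE u v t :
  F u v t = ((sqnorm u + 2 * (f t * inner u v) + f t ^+ 2 * sqnorm v) `^ q)%R.
Proof. by rewrite /F sqnorm_addZ. Qed.

Lemma integral_random_lower u v :
  (sqnorm u `^ q + 2 * 4^-1 `^ q * sqnorm v `^ q)%:E <=
  \int[P]_t (sqnorm (fun m => u m + f t * v m)%R `^ q)%:E.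
Proof.
have [->|Foo] := eqVneq (\int[P]_t (F u v t)%:E) +oo; first by rewrite leey.
have iF : P.-integrable setT (EFin \o F u v).
  apply/integrableP; split => //.
  under eq_integral do rewrite /= ger0_norm ?powR_ge0//.
  by rewrite ltey.
set c := (2 * 4^-1 `^ q * sqnorm v `^ q)%R.
have -> : (sqnorm u `^ q + c = sqnorm u `^ q + 0 * W + c)%R.
  by rewrite mul0r addr0.
rewrite -(int_g _ (2 * q * sqnorm u `^ (q - 1) * inner u v) _ _).2.
apply: le_integral => // [|t _]; first exact: (int_g _ _ _ _).1.
rewrite lee_fin -/(F u v t) FE.
apply: le_trans (powR_uniform_convexity q1 _ _ (cs _ _ _)).
- rewrite /g mul0r addr0 powRM ?sqr_ge0 ?sqnorm_ge0//.
  by rewrite le_eqVlt; apply/orP; left; apply/eqP; rewrite /c; ring.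
- exact: sqnorm_ge0.
- exact: f2B.
Qed.

Lemma integral_random_upper C u v : smoothness_constant q C ->
  \int[P]_t (sqnorm (fun m => u m + f t * v m)%R `^ q)%:E <=
  (sqnorm u `^ q +
   C * (sqnorm u `^ (q - 1) * (W * sqnorm v) + sqnorm v `^ q))%:E.
Proof.
move=> HC.
have gE := int_g (sqnorm u `^ q) (2 * q * sqnorm u `^ (q - 1) * inner u v)
  (C * (sqnorm u `^ (q - 1) * sqnorm v)) (C * sqnorm v `^ q).
have Fg t : (F u v t <= g (sqnorm u `^ q)
    (2 * q * sqnorm u `^ (q - 1) * inner u v)
    (C * (sqnorm u `^ (q - 1) * sqnorm v)) (C * sqnorm v `^ q) t)%R.
  rewrite FE; apply: le_trans (HC _ _ _ (sqnorm_ge0 u) (f2B v t) (cs u v t)) _.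
  rewrite /g powRM ?sqr_ge0 ?sqnorm_ge0//.
  by rewrite le_eqVlt; apply/orP; left; apply/eqP; ring.
rewrite (_ : (_ + C * (_ + _) = sqnorm u `^ q +
  C * (sqnorm u `^ (q - 1) * sqnorm v) * W + C * sqnorm v `^ q)%R);
  last by ring.
rewrite -gE.2; apply: ge0_le_integral => //.
- by move=> t _; rewrite lee_fin powR_ge0.
- by apply/measurable_EFinP; exact: (measurable_EFinP _ _).1 (mF u v).
- by have /integrableP[] := gE.1.
- by move=> t _; rewrite lee_fin; exact: Fg.
Qed.

End one_random_coefficient.

(** * Independence as a Tonelli formula *)

Section independence_of_the_past.
Local Open Scope ereal_scope.
Context d (T : measurableType d) {R : realType} (P : probability T R).
Variables (x : nat -> T -> R).
Hypotheses (mx : forall i, measurable_fun setT (x i))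
  (xindep : independent_sequence P x).
Variable k : nat.

Definition past_event (E : nat -> set R) : set T :=
  \big[setI/setT]_(i <- iota 0 k) (x i @^-1` E i).

Definition past_events : set (set T) :=
  [set A | exists2 E, (forall i, measurable (E i)) & A = past_event E].

Let mpre i (B : set R) : measurable B -> measurable (x i @^-1` B).
Proof. by move=> mB; rewrite -[X in measurable X]setTI; exact: mx. Qed.

Let mpast A : past_events A -> measurable A.
Proof.
move=> [E mE ->]; apply: bigsetI_measurable => i _; exact: mpre.
Qed.

Let past_setI : setI_closed past_events.
Proof.
move=> _ _ [E mE ->] [F mF ->]; exists (fun i => E i `&` F i).
  by move=> i; exact: measurableI.
by rewrite /past_event -big_split.
Qed.

Let past_indep A (B : set R) : past_events A -> measurable B ->
  P (A `&` x k @^-1` B) = P A * P (x k @^-1` B).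
Proof.
move=> [E mE ->] mB.
pose F i := if i == k then B else E i.
have mF i : measurable (F i) by rewrite /F; case: ifP.
have notk i : i \in iota 0 k -> i == k = false.
  by rewrite mem_iota add0n => /andP[_ ik]; rewrite ltn_eqF.
have uk : uniq (k :: iota 0 k).
  by rewrite /= iota_uniq mem_iota add0n ltnn andbF.
have := xindep uk mF; rewrite !big_cons {1 3}/F eqxx setIC muleC.
rewrite -(xindep (iota_uniq 0 k) mF).
rewrite (eq_big_seq (fun i => x i @^-1` E i)); first exact.
by move=> i /notk ik; rewrite /F ik.
Qed.

(** Both sides are finite measures in [A] that agree on the intersection-stable
    family of past events, hence on the sigma-algebra that it generates. *)
Lemma past_independent A (B : set R) : <<s past_events >> A -> measurable B ->
  P (A `&` x k @^-1` B) = P A * P (x k @^-1` B).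
Proof.
move=> sA mB; have mb := mpre k mB.
have finB : P (x k @^-1` B) \is a fin_num by exact: fin_num_measure.
pose r := NngNum (fine_ge0 (measure_ge0 P (x k @^-1` B))).
pose m1 : {measure set T -> \bar R} := mrestr P mb.
pose m2 : {measure set T -> \bar R} := mscale r P.
have m2E C : m2 C = P C * P (x k @^-1` B).
  by rewrite /m2/= /mscale/= fineK// muleC.
rewrite -m2E -[LHS]/(m1 A).
apply: (g_sigma_algebra_measure_unique past_events _ (cst setT)) => //.
- move=> i; exists (cst setT); first by move=> j; exact: measurableT.
  by apply/esym/big1 => j _; exact: preimage_setT.
- by rewrite bigcup_const.
- by move=> C pC; rewrite m2E; exact: past_indep.
- by move=> i; rewrite /m1/= /mrestr setTI ltey_eq finB.
Qed.

Lemma past_measurable A : <<s past_events >> A -> measurable A.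
Proof.
by move: A; apply: smallest_sub => //; exact: sigma_algebra_measurable.
Qed.

Lemma measurable_past i : (i < k)%N ->
  measurable_fun setT (x i : g_sigma_algebraType past_events -> R).
Proof.
move=> ik _ B mB; rewrite setTI; apply: sub_sigma_algebra.
exists (fun j => if j == i then B else setT); first by move=> j; case: ifP.
rewrite /past_event (bigD1_seq i) ?mem_iota ?iota_uniq//= eqxx.
rewrite [X in _ `&` X]big1 ?setIT//.
by move=> j /negbTE ji; rewrite ji preimage_setT.
Qed.

(* The sample space with the coarser sigma-algebra of the past serves as the
   space of values of all the preceding variables together. *)
Let Past := g_sigma_algebraType past_events.

Let toPast : T -> Past := id.

Let measurable_toPast : measurable_fun setT toPast.
Proof. by move=> _ A mA; rewrite setTI; exact: past_measurable. Qed.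

Let toPair : T -> Past * measurableTypeR R := fun w => (w, x k w).

Let measurable_toPair : measurable_fun setT toPair.
Proof.
by apply/measurable_fun_pairP; split; [exact: measurable_toPast|exact: mx].
Qed.

HB.instance Definition _ :=
  isMeasurableFun.Build _ _ _ _ toPast measurable_toPast.

HB.instance Definition _ :=
  isMeasurableFun.Build _ _ _ _ toPair measurable_toPair.

Let xk : T -> measurableTypeR R := x k.

HB.instance Definition _ := isMeasurableFun.Build _ _ _ _ xk (mx k).

(** The law of [w |-> (w, x_k w)] is the product of the restriction of [P] to
    the past with the law of [x_k]. *)
Lemma integral_decouple (F : Past * measurableTypeR R -> \bar R) :
  measurable_fun setT F -> (forall z, 0 <= F z) ->
  \int[P]_w F (w, x k w) = \int[P]_w \int[P]_v F (w, x k v).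
Proof.
move=> mF F0.
rewrite -[LHS]/(\int[P]_w (F \o toPair) w) -ge0_integral_distribution//.
transitivity (\int[(distribution P toPast \x distribution P xk)%E]_z F z).
  apply: eq_measure_integral => A mA _; apply/esym.
  apply: product_measure_unique => //= B C mB mC.
  exact: past_independent.
rewrite fubini_tonelli1// ge0_integral_distribution//; last 2 first.
- exact: measurable_fun_fubini_tonelli_F.
- by move=> w; exact: integral_ge0.
apply: eq_integral => w _ /=; rewrite /fubini_F ge0_integral_distribution//.
exact: measurableT_comp.
Qed.

Lemma measurable_decouple (F : Past * measurableTypeR R -> \bar R) :
  measurable_fun setT F -> (forall z, 0 <= F z) ->
  measurable_fun setT (fun w : T => \int[P]_v F (w, x k v)).
Proof.
move=> mF F0.
rewrite (_ : (fun w => _) = fubini_F (distribution P xk) F \o toPast).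
  apply: measurableT_comp; last exact: measurable_toPast.
  exact: measurable_fun_fubini_tonelli_F.
apply/funext => w /=; rewrite /fubini_F ge0_integral_distribution//.
exact: measurableT_comp.
Qed.

End independence_of_the_past.

(** * Rosenthal's inequality in a Hilbert space *)

(** The choice [s = 2 C V] turns the last term into [J / 2], which is absorbed
    in the left-hand side; if [V = 0], any [s] will do. *)
Lemma self_bound {R : realType} (q C J V L : R) : 1 < q -> 0 < C -> 0 <= J ->
  0 <= V -> 0 <= L ->
  (forall s, 0 < s -> J <= C * (s `^ (q - 1) * V + L) + C * V / s * J) ->
  J <= ((2 * C) `^ q + 2 * C) * (V `^ q + L).
Proof.
move=> q1 C0 J0 V0 L0 H; have q0 : 0 < q by lra.
have Vq0 := powR_ge0 V q; have Cq0 := powR_ge0 (2 * C) q.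
have [V00|Vn0] := eqVneq V 0.
  have := H 1 ltr01; rewrite V00 !(mulr0, mul0r, add0r, addr0) => JCL.
  have := mulr_ge0 Cq0 L0; have := mulr_ge0 Cq0 (powR_ge0 0 q).
  have := mulr_ge0 (ltW C0) L0; have := mulr_ge0 (ltW C0) (powR_ge0 0 q); lra.
have Vpos : 0 < V by rewrite lt_def Vn0.
have s0 : 0 < 2 * C * V by rewrite !mulr_gt0.
have := H _ s0; rewrite (_ : C * V / (2 * C * V) = 2^-1); last first.
  by field; rewrite Vn0 gt_eqF.
have := mulr_powRB1 (ltW s0) q0; move: (_ `^ (q - 1)) => z.
rewrite powRM// ?mulr_ge0 ?(ltW C0)// => zE JH.
have := mulr_ge0 Cq0 L0; have := mulr_ge0 (ltW C0) Vq0; lra.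
Qed.

(** Used with [y = |S_N|^2], to bound a second moment by a [p]-th moment without
    any loss of homogeneity once [s] is optimised. *)
Lemma le_add_powR_div {R : realType} (q s y : R) : 1 < q -> 0 < s -> 0 <= y ->
  y <= s + y `^ q / s `^ (q - 1).
Proof.
move=> q1 s0 y0; have s'0 : 0 < s `^ (q - 1) by exact: powR_gt0.
have [ys|sy] := leP y s.
  by apply: le_trans ys _; rewrite lerDl divr_ge0 ?powR_ge0.
apply: (@le_trans _ _ (y `^ q / s `^ (q - 1))); last by rewrite lerDr ltW.
rewrite ler_pdivlMr// -(@mulr_powRB1 _ y q)//; last by lra.
by apply: ler_wpM2l => //; apply: ge0_ler_powR; rewrite ?nnegrE; lra.
Qed.

(** One step of the summation of the upper bounds: [j] and [j'] are successive
    moments, [jN] the last one, and [V], [L] the partial sums of the [v]s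
    and [l]s. *)
Lemma moment_recursion {R : realType} (C t s V L v l j j' jN : R) :
  j <= C * (t * V + L) + C * V / s * jN ->
  j' <= (1 + C * v / s) * j + C * (t * v + l) ->
  C * v / s * j <= C * v / s * jN ->
  j' <= C * (t * (V + v) + (L + l)) + C * (V + v) / s * jN.
Proof. by move: s^-1 => r; lra. Qed.

Section rosenthal.
Local Open Scope ereal_scope.
Context d (T : measurableType d) {R : realType} (P : probability T R).
Variables (q : R) (W : nat -> R) (x : nat -> T -> R).
Hypotheses (q1 : (1 < q)%R) (mx : forall i, measurable_fun setT (x i))
  (xindep : independent_sequence P x).
Hypothesis x_mean : forall i, \int[P]_t (x i t)%:E = 0.
Hypothesis x_sq : forall i, \int[P]_t (x i t ^+ 2)%:E = (W i)%:E.
Hypothesis x_pow : forall i, \int[P]_t ((x i t ^+ 2) `^ q)%:E = 1.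
Hypothesis x_int : forall i, P.-integrable setT (EFin \o x i).

Section fixed_coefficients.
Context {M : finType}.
Variable c : nat -> M -> R.

Definition partial_sum k t : M -> R := (fun m => \sum_(i < k) c i m * x i t)%R.

Let S := partial_sum.
Let B i := sqnorm (c i).

Let SS k t : S k.+1 t = (fun m => S k t m + x k t * c k m)%R.
Proof.
apply/funext => m.
by rewrite /S /partial_sum big_ord_recr/= [(x k t * _)%R]mulrC.
Qed.

Let S0 t : sqnorm (S 0 t) = 0%R.
Proof.
by rewrite /sqnorm big1// => m _; rewrite /S /partial_sum big_ord0 expr0n.
Qed.

Let mS k : measurable_fun setT (fun t => sqnorm (S k t)).
Proof.
apply: measurable_sum => m; apply: measurable_funX; apply: measurable_sum => i.
exact: measurable_funM.
Qed.

Let decouple k (phi : R -> R) : measurable_fun setT phi ->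
  (forall y, 0 <= y -> 0 <= phi y)%R ->
  let G w := \int[P]_v (phi (sqnorm (fun m => S k w m + x k v * c k m)%R))%:E in
  measurable_fun setT G /\
  \int[P]_t (phi (sqnorm (S k.+1 t)))%:E = \int[P]_w G w.
Proof.
move=> mphi phi0 /=.
pose F (z : g_sigma_algebraType (past_events x k) * measurableTypeR R) :=
  (phi (sqnorm (fun m => S k z.1 m + z.2 * c k m)%R))%:E.
have F0 z : 0 <= F z by rewrite lee_fin phi0// sqnorm_ge0.
have mF : measurable_fun setT F.
  apply/measurable_EFinP; apply: (measurableT_comp mphi).
  apply: measurable_sum => m; apply: measurable_funX; apply: measurable_funD.
    apply: measurable_sum => i; apply: measurable_funM => //.
    apply: measurableT_comp => //; exact: measurable_past.
  exact: measurable_funM.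
split; first exact: (measurable_decouple P mx mF F0).
under eq_integral do rewrite SS.
exact: (integral_decouple mx xindep mF F0).
Qed.

Definition moment k := \int[P]_t (sqnorm (S k t) `^ q)%:E.

(** Orthogonality of centred independent variables. *)
Lemma second_moment k :
  \int[P]_t (sqnorm (S k t))%:E = (\sum_(i < k) W i * B i)%:E.
Proof.
elim: k => [|k ih].
  by rewrite big_ord0; under eq_integral do rewrite S0; rewrite integral0.
have [_ ->] := @decouple k id (@measurable_id _ _ _) (fun y y0 => y0).
under eq_integral do rewrite (integral_sqnorm_random (mx k) (x_mean k)
  (x_sq k) (x_pow k) (x_int k)) EFinD.
rewrite ge0_integralD//=.
- rewrite ih integral_cst//= probability_setT mule1 big_ord_recr/=.
  by rewrite EFinD.
- by move=> t _; rewrite lee_fin sqnorm_ge0.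
- exact/measurable_EFinP.
- move=> t _; rewrite lee_fin mulr_ge0 ?sqnorm_ge0//.
  by rewrite -lee_fin -x_sq integral_ge0// => v _; rewrite lee_fin sqr_ge0.
Qed.

Let mSq k r : measurable_fun setT (fun t => sqnorm (S k t) `^ r)%R.
Proof. exact: (measurableT_comp (measurable_powR _)). Qed.

Let powR_phi r : measurable_fun setT (fun y : R => y `^ r)%R /\
  (forall y : R, 0 <= y -> 0 <= y `^ r)%R.
Proof. by split => [|y _]; [exact: measurable_powR|exact: powR_ge0]. Qed.

Lemma moment_lower_step k :
  moment k + (2 * 4^-1 `^ q * B k `^ q)%:E <= moment k.+1.
Proof.
have [mG decE] := decouple k (powR_phi q).1 (powR_phi q).2.
rewrite /moment decE.
set b := (2 * _ * _)%R.
have b0 : (0 <= b)%R by rewrite !mulr_ge0// powR_ge0.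
rewrite -[b%:E]mule1 -(probability_setT P) -integral_cst// -ge0_integralD//=.
- apply: ge0_le_integral => //.
  + by move=> t _; rewrite adde_ge0 ?lee_fin ?powR_ge0.
  + by apply/measurable_EFinP; apply: measurable_funD.
  + move=> t _; rewrite -EFinD.
    exact: (integral_random_lower q1 (mx k) (x_mean k)
      (x_sq k) (x_pow k) (x_int k)).
- by move=> t _; rewrite lee_fin powR_ge0.
- exact/measurable_EFinP.
Qed.

Let W0 k : (0 <= W k)%R.
Proof.
by rewrite -lee_fin -x_sq integral_ge0// => t _; rewrite lee_fin sqr_ge0.
Qed.

Let powR_le_split (s y : R) : (0 < s -> 0 <= y ->
  y `^ (q - 1) <= s `^ (q - 1) + y `^ q / s)%R.
Proof.
move=> s0 y0; have [ys|sy] := leP y s.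
  apply: (@le_trans _ _ (s `^ (q - 1))%R).
    by apply: ge0_ler_powR; rewrite ?nnegrE ?subr_ge0// ltW.
  by rewrite lerDl divr_ge0 ?powR_ge0// ltW.
apply: (@le_trans _ _ (y `^ q / s)%R); last by rewrite lerDr powR_ge0.
have q0 : (0 < q)%R by exact: lt_trans q1.
rewrite -(mulr_powRB1 y0 q0) mulrAC.
by rewrite ler_peMl ?powR_ge0// ler_pdivlMr// mul1r ltW.
Qed.

(** The moment of order [p - 2] that the smoothness inequality produces is split
    at the squared radius [s] into a constant and a multiple of the moment of
    order [p]. *)
Lemma moment_upper_step C s k : (0 < C)%R -> (0 < s)%R ->
  smoothness_constant q C ->
  moment k.+1 <= (1 + C * (W k * B k) / s)%:E * moment k +
    (C * (s `^ (q - 1) * (W k * B k) + B k `^ q))%:E.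
Proof.
move=> C0 s0 HC.
have [mG decE] := decouple k (powR_phi q).1 (powR_phi q).2.
have WB0 : (0 <= W k * B k)%R by rewrite mulr_ge0// sqnorm_ge0.
set a := (1 + _)%R; set b := (C * (_ + _))%R.
have [C0' s0'] := (ltW C0, ltW s0).
have a0 : (0 <= a)%R.
  by apply: addr_ge0 => //; apply: divr_ge0 => //; exact: mulr_ge0.
have b0 : (0 <= b)%R.
  apply: mulr_ge0 => //; apply: addr_ge0; last exact: powR_ge0.
  by apply: mulr_ge0 => //; exact: powR_ge0.
rewrite /moment decE -[b%:E]mule1 -(probability_setT P) -integral_cst//.
rewrite -ge0_integralZl//; last 2 first.
- exact/measurable_EFinP.
- by move=> t _; rewrite lee_fin powR_ge0.
rewrite -ge0_integralD//=; last 2 first.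
- by move=> t _; rewrite -EFinM lee_fin mulr_ge0 ?powR_ge0.
- by apply/measurable_EFinP; exact: measurable_funM.
apply: ge0_le_integral => //.
- by move=> t _; apply: integral_ge0 => v _; rewrite lee_fin powR_ge0.
- apply/measurable_EFinP; apply: measurable_funD => //.
  exact: measurable_funM.
move=> t _; apply: le_trans (integral_random_upper (mx k) (x_mean k)
  (x_sq k) (x_pow k) (x_int k) (S k t) (c k) HC) _.
rewrite -EFinM -EFinD lee_fin /a /b -/(B k).
have := powR_le_split s0 (sqnorm_ge0 (S k t)).
move: (sqnorm (S k t) `^ q)%R (sqnorm (S k t) `^ (q - 1))%R => y z zy.
have := ler_wpM2l (mulr_ge0 (ltW C0) WB0) zy.
by rewrite [(C * (W k * B k) / s)%R]mulrAC; lra.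
Qed.

Lemma moment_ge0 k : 0 <= moment k.
Proof. by apply: integral_ge0 => t _; rewrite lee_fin powR_ge0. Qed.

Lemma moment_fin_num k : moment k \is a fin_num.
Proof.
have [C C0 HC] := exists_smoothness_constant q1.
elim: k => [|k ih].
  rewrite /moment.
  under eq_integral do rewrite S0 powR0 ?gt_eqF ?(lt_trans ltr01)//.
  by rewrite integral0.
rewrite ge0_fin_numE ?moment_ge0//.
apply: le_lt_trans (moment_upper_step k C0 ltr01 HC) _.
by rewrite -(fineK ih) -EFinM -EFinD ltry.
Qed.

Let J k := fine (moment k).

Let JE k : moment k = (J k)%:E. Proof. by rewrite fineK// moment_fin_num. Qed.

Let V k := (\sum_(i < k) W i * B i)%R.
Let L k := (\sum_(i < k) B i `^ q)%R.

Let J0 k : (0 <= J k)%R. Proof. by rewrite -lee_fin -JE moment_ge0. Qed.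

Let V_ge0 k : (0 <= V k)%R.
Proof. by apply: sumr_ge0 => i _; rewrite mulr_ge0// sqnorm_ge0. Qed.

Let L_ge0 k : (0 <= L k)%R.
Proof. by apply: sumr_ge0 => i _; rewrite powR_ge0. Qed.

Let e : R := (2 * 4^-1 `^ q)%R.

Let e0 : (0 < e)%R. Proof. by rewrite mulr_gt0// powR_gt0. Qed.

Let J_step k : (J k + e * B k `^ q <= J k.+1)%R.
Proof. by rewrite -lee_fin EFinD -!JE; exact: moment_lower_step. Qed.

(* Monotonicity makes it possible to replace every moment in the sum of the
   upper bounds by the last one. *)
Let J_mono k N : (k <= N)%N -> (J k <= J N)%R.
Proof.
elim: N => [|N ih]; first by rewrite leqn0 => /eqP ->.
rewrite leq_eqVlt => /predU1P[->//|/ih kN].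
apply: le_trans kN (le_trans _ (J_step N)).
by rewrite lerDl mulr_ge0 ?powR_ge0// ltW.
Qed.

Let J_lower N : (e * L N <= J N)%R.
Proof.
elim: N => [|N ih]; first by rewrite /L big_ord0 mulr0.
by apply: le_trans (J_step N); rewrite /L big_ord_recr/= mulrDr lerD2r.
Qed.

Let J_upper C N (s : R) : (0 < C)%R -> (0 < s)%R ->
  smoothness_constant q C ->
  (J N <= C * (s `^ (q - 1) * V N + L N) + C * V N / s * J N)%R.
Proof.
move=> C0 s0 HC.
suff H k : (k <= N)%N ->
    (J k <= C * (s `^ (q - 1) * V k + L k) + C * V k / s * J N)%R by exact: H.
elim: k => [_|k ih kN].
  rewrite /V /L !big_ord0 !(mulr0, mul0r, add0r, addr0).
  rewrite -lee_fin -JE /moment.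
  under eq_integral do rewrite S0 powR0 ?gt_eqF ?(lt_trans ltr01)//.
  by rewrite integral0.
have step := moment_upper_step k C0 s0 HC.
rewrite !JE -EFinM -EFinD lee_fin in step.
have JkN : (C * (W k * B k) / s * J k <= C * (W k * B k) / s * J N)%R.
  apply: ler_wpM2l; last by apply: J_mono; exact: ltnW.
  apply: divr_ge0; last exact: ltW.
  by apply: mulr_ge0; [exact: ltW|rewrite mulr_ge0// sqnorm_ge0].
rewrite /V /L !big_ord_recr/=.
exact: moment_recursion (ih (ltnW kN)) step JkN.
Qed.

(* Half of V is the level s at which the second moment is cut; the other half
   is then controlled by the p-th moment. *)
Let V_le_J N : (V N `^ q <= 2 `^ q * J N)%R.
Proof.
have q0 : (0 < q)%R by exact: lt_trans q1.
have [->|Vn0] := eqVneq (V N) 0%R.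
  by rewrite powR0 ?gt_eqF// mulr_ge0 ?powR_ge0.
have Vpos : (0 < V N / 2)%R by rewrite divr_gt0// lt_def Vn0 V_ge0.
set s := (V N / 2)%R in Vpos *.
have s'0 : (0 < s `^ (q - 1))%R by exact: powR_gt0.
have : (V N)%:E <= s%:E + (s `^ (q - 1))^-1%:E * moment N.
  rewrite -second_moment -[s%:E]mule1 -(probability_setT P) -integral_cst//.
  rewrite -ge0_integralZl//; last 3 first.
  - exact/measurable_EFinP.
  - by move=> t _; rewrite lee_fin powR_ge0.
  - by rewrite lee_fin invr_ge0 ltW.
  rewrite -ge0_integralD//=; last 3 first.
  - by move=> t _; rewrite lee_fin ltW.
  - by move=> t _; rewrite -EFinM lee_fin mulr_ge0 ?powR_ge0// invr_ge0 ltW.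
  - by apply/measurable_EFinP; exact: measurable_funM.
  apply: ge0_le_integral => //.
  - by move=> t _; rewrite lee_fin sqnorm_ge0.
  - exact/measurable_EFinP.
  - apply/measurable_EFinP; apply: measurable_funD => //.
    exact: measurable_funM.
  - move=> t _; rewrite -EFinM -EFinD lee_fin mulrC.
    by apply: le_add_powR_div => //; exact: sqnorm_ge0.
rewrite JE -EFinM -EFinD lee_fin mulrC => VJ.
have {}VJ : (s <= J N / s `^ (q - 1))%R.
  by move: VJ; rewrite (_ : V N = s + s)%R ?lerD2l// /s; field.
move: VJ; rewrite ler_pdivlMr// (mulr_powRB1 (ltW Vpos) q0) => VJ.
rewrite (_ : V N = 2 * s)%R; last by rewrite /s; field.
by rewrite (powRM _ _ (ltW Vpos))//; apply: ler_wpM2l => //; exact: powR_ge0.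
Qed.

Lemma moment_two_sided C N : (0 < C)%R -> smoothness_constant q C ->
  moment N <= (((2 * C) `^ q + 2 * C) * (V N `^ q + L N))%:E /\
  (V N `^ q + L N)%:E <= (2 `^ q + e^-1)%:E * moment N.
Proof.
move=> C0 HC; rewrite JE -EFinM !lee_fin; split.
  by apply: self_bound => // s s0; exact: J_upper.
rewrite mulrDl; apply: lerD; first exact: V_le_J.
by rewrite mulrC ler_pdivlMr// mulrC; exact: J_lower.
Qed.

End fixed_coefficients.

(** The same constant has to serve all dimensions [M]: the induction on the
    number of tensor factors enlarges the dimension at each step. *)
Definition rosenthal_constant (K : R) := forall (M : finType)
    (c : nat -> M -> R) (N : nat),
  let Q := ((\sum_(i < N) W i * sqnorm (c i)) `^ q +
            \sum_(i < N) sqnorm (c i) `^ q)%R in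
  moment c N <= (K * Q)%:E /\ Q%:E <= K%:E * moment c N.

Theorem rosenthal : exists2 K : R, (0 < K)%R & rosenthal_constant K.
Proof.
have [C C0 HC] := exists_smoothness_constant q1.
pose K1 : R := ((2 * C) `^ q + 2 * C)%R.
pose K2 : R := (2 `^ q + (2 * 4^-1 `^ q)^-1)%R.
have K10 : (0 < K1)%R by rewrite ltr_wpDl ?powR_ge0// mulr_gt0.
have K20 : (0 < K2)%R.
  by rewrite ltr_wpDl ?powR_ge0// invr_gt0 mulr_gt0// powR_gt0.
exists (K1 + K2)%R => [|M c N Q]; first by rewrite addr_gt0.
have Q0 : (0 <= Q)%R.
  by rewrite addr_ge0 ?powR_ge0// sumr_ge0// => i _; rewrite powR_ge0.
have [up lo] := moment_two_sided c N C0 HC; split.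
  by apply: le_trans up _; rewrite lee_fin ler_wpM2r// lerDl ltW.
apply: le_trans lo _; apply: lee_wpmul2r; first exact: moment_ge0.
by rewrite lee_fin lerDr ltW.
Qed.

End rosenthal.

(** * Recursion on the number of indices for mixed norms *)

Section tuple_sums.

Lemma big_tuple_cons {V : nmodType} {I : finType} n (p : pred (n.+1.-tuple I))
    (F : n.+1.-tuple I -> V) :
  \sum_(i | p i) F i =
  \sum_(i0 : I) \sum_(i : n.-tuple I | p [tuple of i0 :: i])
    F [tuple of i0 :: i].
Proof.
rewrite (reindex (fun u : I * n.-tuple I => [tuple of u.1 :: u.2])) /=;
  last first.
  exists (fun i : n.+1.-tuple I => (thead i, [tuple of behead i]));
      [move=> [i0 i] _|move=> i _].
    by congr pair; apply: val_inj.
  by apply: val_inj => /=; rewrite [in RHS](tuple_eta i).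
by rewrite (pair_big_dep xpredT
  (fun i0 (i : n.-tuple I) => p [tuple of i0 :: i])
  (fun i0 (i : n.-tuple I) => F [tuple of i0 :: i])).
Qed.

Lemma big_tuple0 {V : nmodType} {I : finType} (p : pred (0.-tuple I))
    (F : 0.-tuple I -> V) : p [tuple] ->
  \sum_(i | p i) F i = F [tuple].
Proof.
move=> p0; rewrite (big_pred1 [tuple])// => i.
by rewrite [i]tuple0 p0; apply/esym/eqP.
Qed.

Lemma forall_ord_recl n (p : pred 'I_n.+1) :
  [forall k, p k] = p ord0 && [forall k : 'I_n, p (lift ord0 k)].
Proof.
apply/forallP/andP => [h|[p0 /forallP h] k]; first by split; [|apply/forallP].
by case: (unliftP ord0 k) => [k' ->|->].
Qed.

End tuple_sums.

(** The [p]-th powers of the mixed norms, for coefficients with values in [R^M]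
    and indices bounded by [N].  A set [S] of positions is given by its
    indicator, a tuple [b] of booleans, so that sets and multi-indices are
    decomposed in the same way. *)
Section mixed_powers.
Context {R : realType}.
Variables (q : R) (w : nat -> R) (N : nat).
Local Notation I := 'I_N.+1.
Implicit Type M : finType.

(** As in the statement, the free choice of the indices in [S] is encoded by a
    multi-index that vanishes outside [S]. *)
Definition outer n (b : n.-tuple bool) (j : n.-tuple I) : bool :=
  [forall k, ~~ tnth b k ==> (tnth j k == ord0)].

Definition agree n (b : n.-tuple bool) (j i : n.-tuple I) : bool :=
  [forall k, tnth b k ==> (tnth i k == tnth j k)].

Definition weight n (b : n.-tuple bool) (i : n.-tuple I) : R :=
  \prod_k (if tnth b k then 1 else w (tnth i k) ^+ 2).

Definition mixed_power n M (a : n.-tuple I -> M -> R) (b : n.-tuple bool) : R :=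
  \sum_(j | outer b j) (\sum_(i | agree b j i) sqnorm (a i) * weight b i) `^ q.

Definition head_fixed n M (a : n.+1.-tuple I -> M -> R) (i0 : I) :=
  fun i : n.-tuple I => a [tuple of i0 :: i].

(** The weights are such that the squared norm of the new values is the weighted
    sum, over the first index, of the squared norms of the old ones
    ([sqnorm_weighted]): the part of the inner sum of a mixed norm that involves
    this index. *)
Definition head_summed n M (a : n.+1.-tuple I -> M -> R) :=
  fun (i : n.-tuple I) (u : I * M) => w u.1 * a [tuple of u.1 :: i] u.2.

Lemma sqnorm_weighted M (v : I -> M -> R) :
  sqnorm (fun u : I * M => w u.1 * v u.1 u.2) =
  \sum_(i0 : I) w i0 ^+ 2 * sqnorm (v i0).
Proof.
rewrite /sqnorm -(pair_bigA _ (fun (i0 : I) m => (w i0 * v i0 m) ^+ 2))/=.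
apply: eq_bigr => i0 _; rewrite mulr_sumr.
by apply: eq_bigr => m _; rewrite exprMn.
Qed.

Lemma outer_cons n b0 (b : n.-tuple bool) i0 (j : n.-tuple I) :
  outer [tuple of b0 :: b] [tuple of i0 :: j] =
  (~~ b0 ==> (i0 == ord0)) && outer b j.
Proof.
rewrite /outer forall_ord_recl !tnth0; congr andb.
by apply: eq_forallb => k; rewrite !tnthS.
Qed.

Lemma agree_cons n b0 (b : n.-tuple bool) j0 (j : n.-tuple I)
    i0 (i : n.-tuple I) :
  agree [tuple of b0 :: b] [tuple of j0 :: j] [tuple of i0 :: i] =
  (b0 ==> (i0 == j0)) && agree b j i.
Proof.
rewrite /agree forall_ord_recl !tnth0; congr andb.
by apply: eq_forallb => k; rewrite !tnthS.
Qed.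

Lemma weight_cons n b0 (b : n.-tuple bool) i0 (i : n.-tuple I) :
  weight [tuple of b0 :: b] [tuple of i0 :: i] =
  (if b0 then 1 else w i0 ^+ 2) * weight b i.
Proof.
rewrite /weight big_ord_recl !tnth0; congr *%R.
by apply: eq_bigr => k _; rewrite !tnthS.
Qed.

(** An index in [S] is summed outside the power. *)
Lemma mixed_power_cons_true n M (a : n.+1.-tuple I -> M -> R)
    (b : n.-tuple bool) :
  mixed_power a [tuple of true :: b] = \sum_i0 mixed_power (head_fixed a i0) b.
Proof.
rewrite /mixed_power big_tuple_cons; apply: eq_bigr => j0 _.
apply: eq_big => [j|j _]; first by rewrite outer_cons.
congr powR; rewrite big_tuple_cons (bigD1 j0)//= [X in _ + X]big1 => [|i0 i0j0].
  rewrite addr0; apply: eq_big => [i|i _]; first by rewrite agree_cons/= eqxx.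
  by rewrite weight_cons mul1r.
by rewrite big_pred0// => i; rewrite agree_cons/= (negbTE i0j0).
Qed.

(** An index outside [S] is summed inside the power, as part of the squared
    norm; in the outer sum it only takes the value 0. *)
Lemma mixed_power_cons_false n M (a : n.+1.-tuple I -> M -> R)
    (b : n.-tuple bool) :
  mixed_power a [tuple of false :: b] = mixed_power (head_summed a) b.
Proof.
rewrite /mixed_power big_tuple_cons (bigD1 ord0)//=.
rewrite [X in _ + X]big1 => [|j0 j00].
  rewrite addr0; apply: eq_big => [j|j _]; first by rewrite outer_cons/=.
  congr powR; rewrite big_tuple_cons.
  rewrite (eq_bigr (fun i0 : I => \sum_(i | agree b j i)
      sqnorm (a [tuple of i0 :: i]) * (w i0 ^+ 2 * weight b i))); last first.
    move=> i0 _; apply: eq_big => [i|i _]; first by rewrite agree_cons.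
    by rewrite weight_cons.
  rewrite exchange_big/=; apply: eq_bigr => i _.
  rewrite (sqnorm_weighted (fun i0 => a [tuple of i0 :: i])) mulr_suml.
  by apply: eq_bigr => i0 _; rewrite mulrCA mulrA.
by rewrite big_pred0// => j; rewrite outer_cons/= (negbTE j00).
Qed.

Definition total_power n M (a : n.-tuple I -> M -> R) : R :=
  \sum_b mixed_power a b.

Lemma total_power_cons n M (a : n.+1.-tuple I -> M -> R) :
  total_power a =
  total_power (head_summed a) + \sum_i0 total_power (head_fixed a i0).
Proof.
rewrite /total_power big_tuple_cons big_bool/= addrC; congr (_ + _).
  by apply: eq_bigr => b _; rewrite mixed_power_cons_false.
rewrite exchange_big; apply: eq_bigr => b _.
by rewrite mixed_power_cons_true.
Qed.

Lemma total_power0 M (a : 0.-tuple I -> M -> R) :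
  total_power a = sqnorm (a [tuple]) `^ q.
Proof.
rewrite /total_power big_tuple0// /mixed_power big_tuple0; last first.
  by apply/forallP => -[].
rewrite big_tuple0; last by apply/forallP => -[].
by rewrite /weight big_ord0 mulr1.
Qed.

End mixed_powers.

(** * Sums of tensor products *)

Section tensor_products.
Local Open Scope ereal_scope.
Context d (T : measurableType d) {R : realType} (P : probability T R).
Variables (q : R) (w : nat -> R) (x : nat -> T -> R).
Hypothesis mx : forall i, measurable_fun setT (x i).
Variable N : nat.
Local Notation I := 'I_N.+1.
Implicit Type M : finType.

Definition vector_sum n M (a : n.-tuple I -> M -> R) (t : n.-tuple T) :
    M -> R := (fun m => \sum_i a i m * tensor x [tuple of map val i] t)%R.

Definition tensor_moment n M (a : n.-tuple I -> M -> R) : \bar R :=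
  \int[power_probability P n]_t (sqnorm (vector_sum a t) `^ q)%:E.

Lemma tensor_cons i0 n (i : n.-tuple I) t0 (t : n.-tuple T) :
  tensor x [tuple of map val [tuple of i0 :: i]] [tuple of t0 :: t] =
  (x (val i0) t0 * tensor x [tuple of map val i] t)%R.
Proof.
rewrite /tensor big_ord_recl !tnth0; congr (x _ _ * _)%R.
by apply: eq_bigr => k _; rewrite !tnth_map !tnthS.
Qed.

Lemma vector_sum_cons n M (a : n.+1.-tuple I -> M -> R) t0 (t : n.-tuple T) :
  vector_sum a [tuple of t0 :: t] =
  partial_sum x (fun i => vector_sum (head_fixed a (inord i)) t) N.+1 t0.
Proof.
apply/funext => m; rewrite /vector_sum /partial_sum big_tuple_cons.
apply: eq_bigr => i0 _; rewrite mulr_suml; apply: eq_bigr => i _.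
by rewrite tensor_cons inord_val /head_fixed mulrCA mulrC.
Qed.

Lemma vector_sum_head_summed n M (a : n.+1.-tuple I -> M -> R)
    (t : n.-tuple T) :
  sqnorm (vector_sum (head_summed w a) t) =
  (\sum_(i0 < N.+1)
     w i0 ^+ 2 * sqnorm (vector_sum (head_fixed a (inord i0)) t))%R.
Proof.
under eq_bigr do rewrite inord_val.
rewrite -(sqnorm_weighted w (fun i0 => vector_sum (head_fixed a i0) t)).
apply: eq_bigr => -[i0 m] _; congr (_ ^+ 2)%R; rewrite /vector_sum mulr_sumr.
by apply: eq_bigr => i _; rewrite mulrA.
Qed.

Lemma measurable_vector_sum n M (a : n.-tuple I -> M -> R) :
  measurable_fun setT (fun t => sqnorm (vector_sum a t) `^ q)%R.
Proof.
apply: (measurableT_comp (measurable_powR _)).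
apply: measurable_sum => m; apply: measurable_funX; apply: measurable_sum => i.
apply: measurable_funM => //; apply: measurable_prod => k _.
apply: measurableT_comp => //; exact: measurable_tnth.
Qed.

Lemma tensor_moment_ge0 n M (a : n.-tuple I -> M -> R) : 0 <= tensor_moment a.
Proof. by apply: integral_ge0 => t _; rewrite lee_fin powR_ge0. Qed.

(** Tonelli: the integral in the first variable is the [p]-th moment of a sum
    of the [x i] whose coefficients are the sums over the other indices. *)
Lemma tensor_moment_cons n M (a : n.+1.-tuple I -> M -> R) :
  let G (t : n.-tuple T) := moment P q x
    (fun i => vector_sum (head_fixed a (inord i)) t) N.+1 in
  measurable_fun setT G /\
  tensor_moment a = \int[power_probability P n]_t G t.
Proof.
rewrite /tensor_moment /=.
pose f t := (sqnorm (vector_sum a t) `^ q)%R.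
have mf : measurable_fun setT (EFin \o f).
  by apply/measurable_EFinP; exact: measurable_vector_sum.
have f0 t : 0 <= (EFin \o f) t.
  by rewrite lee_fin powR_ge0.
rewrite -[X in _ /\ X = _]/(\int[_]_t
  ((EFin \o f) t)).
rewrite ge0_integral_distribution//.
have mfc : measurable_fun setT
  ((EFin \o f) \o @cons_pair _ T n).
  exact: measurableT_comp.
pose G (t : n.-tuple T) := moment P q x
  (fun i => vector_sum (head_fixed a (inord i)) t) N.+1.
have GE : G = fubini_G P
    ((EFin \o f) \o @cons_pair _ T n).
  apply/funext => t; rewrite /G /moment /fubini_G.
  apply: eq_integral => t0 _ /=.
  by rewrite -vector_sum_cons.
rewrite -[X in measurable_fun _ X]/G -[X in _ = X]/(\int[_]_t G t) GE; split.
  by apply: measurable_fun_fubini_tonelli_G => // z; exact: f0.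
by apply: fubini_tonelli2 => // z; exact: f0.
Qed.

(** Rosenthal's inequality in the first variable, integrated over the others. *)
Lemma tensor_moment_step K : (0 < K)%R ->
  rosenthal_constant P q (fun i => w i ^+ 2)%R x K ->
  forall n M (a : n.+1.-tuple I -> M -> R),
  let X := tensor_moment (head_summed w a) +
           \sum_i0 tensor_moment (head_fixed a i0) in
  tensor_moment a <= K%:E * X /\ X <= K%:E * tensor_moment a.
Proof.
move=> K0 HK n M a X.
have [mG ->] := tensor_moment_cons a.
pose Y (t : n.-tuple T) : R := (sqnorm (vector_sum (head_summed w a) t) `^ q +
  \sum_i0 sqnorm (vector_sum (head_fixed a i0) t) `^ q)%R.
have mY : measurable_fun setT Y.
  apply: measurable_funD; first exact: measurable_vector_sum.
  by apply: measurable_sum => i0; exact: measurable_vector_sum.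
have Y0 t : (0 <= Y t)%R.
  by rewrite addr_ge0 ?powR_ge0// sumr_ge0// => i0 _; rewrite powR_ge0.
have XE : X = \int[power_probability P n]_t (Y t)%:E.
  under eq_integral do rewrite EFinD -sumEFin.
  rewrite ge0_integralD//=; last 4 first.
  - by move=> t _; rewrite lee_fin powR_ge0.
  - by apply/measurable_EFinP; exact: measurable_vector_sum.
  - by move=> t _; apply: sume_ge0 => i0 _; rewrite lee_fin powR_ge0.
  - apply: emeasurable_sum => i0.
    by apply/measurable_EFinP; exact: measurable_vector_sum.
  rewrite ge0_integral_sum//.
  - by move=> i0; apply/measurable_EFinP; exact: measurable_vector_sum.
  - by move=> i0 t _; rewrite lee_fin powR_ge0.
have YE t : (Y t = (\sum_(i < N.+1) w i ^+ 2 *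
      sqnorm (vector_sum (head_fixed a (inord i)) t)) `^ q +
    \sum_(i < N.+1) sqnorm (vector_sum (head_fixed a (inord i)) t) `^ q)%R.
  rewrite /Y vector_sum_head_summed; congr (_ + _)%R.
  by apply: eq_bigr => i0 _; rewrite inord_val.
have HY t := HK M (fun i => vector_sum (head_fixed a (inord i)) t) N.+1.
rewrite /= in HY.
have G0 t : 0 <= moment P q x
    (fun i => vector_sum (head_fixed a (inord i)) t) N.+1.
  exact: moment_ge0.
have K0' : 0 <= K%:E by rewrite lee_fin ltW.
have mYE : measurable_fun setT (EFin \o Y) by exact/measurable_EFinP.
have Y0E t : 0 <= (Y t)%:E by rewrite lee_fin.
rewrite XE -(ge0_integralZl _ measurableT mYE (fun t _ => Y0E t) K0').
rewrite -(ge0_integralZl _ measurableT mG (fun t _ => G0 t) K0').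
split; apply: ge0_le_integral => //.
- by apply/measurable_EFinP; exact: measurable_funM.
- by move=> t _; rewrite /= -EFinM YE; exact: (HY t).1.
- exact: measurable_funeM.
- by move=> t _; rewrite YE; exact: (HY t).2.
Qed.

(** Each tensor factor costs one factor [K]. *)
Theorem tensor_rosenthal K n : (0 < K)%R ->
  rosenthal_constant P q (fun i => w i ^+ 2)%R x K ->
  forall M (a : n.-tuple I -> M -> R),
  tensor_moment a <= (K ^+ n * total_power q w a)%:E /\
  (total_power q w a)%:E <= (K ^+ n)%:E * tensor_moment a.
Proof.
move=> K0 HK; elim: n => [|n ih] M a.
  rewrite total_power0 expr0 mul1r mul1e /tensor_moment /=.
  rewrite integral_dirac//=; last first.
    by apply/measurable_EFinP; exact: measurable_vector_sum.
  rewrite diracT mul1e (_ : vector_sum a [tuple] = a [tuple])//.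
  apply/funext => m; rewrite /vector_sum big_tuple0//.
  by rewrite /tensor big_ord0 mulr1.
have [up lo] := tensor_moment_step K0 HK a.
have Kn0 : (0 <= K ^+ n)%R by rewrite exprn_ge0// ltW.
have sum0 : 0 <= \sum_i0 tensor_moment (head_fixed a i0).
  by apply: sume_ge0 => i0 _; exact: tensor_moment_ge0.
rewrite total_power_cons; split.
  apply: le_trans up _; rewrite exprS -mulrA EFinM.
  apply: lee_wpmul2l; first by rewrite lee_fin ltW.
  rewrite mulrDr EFinD; apply: leeD; first exact: (ih _ _).1.
  rewrite mulr_sumr -sumEFin.
  by apply: lee_sum => i0 _; exact: (ih _ _).1.
apply: (@le_trans _ _ ((K ^+ n)%:E * (tensor_moment (head_summed w a) +
           \sum_i0 tensor_moment (head_fixed a i0)))).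
  rewrite EFinD ge0_muleDr ?tensor_moment_ge0//.
  apply: leeD; first exact: (ih _ _).2.
  rewrite -sumEFin ge0_sume_distrr => [|i0 _]; last exact: tensor_moment_ge0.
  by apply: lee_sum => i0 _; exact: (ih _ _).2.
by rewrite exprSr EFinM -muleA; apply: lee_wpmul2l; rewrite ?lee_fin.
Qed.

End tensor_products.

(** * Finitely supported families *)

Section truncation.
Context {R : realType} {n N : nat}.
Local Notation I := 'I_N.+1.

Definition val_tuple (i : n.-tuple I) : n.-tuple nat := [tuple of map val i].

Lemma val_tuple_inj : injective val_tuple.
Proof. by move=> i j /(congr1 val)/= /(inj_map val_inj) /val_inj. Qed.

Lemma val_tuple_surj (i : n.-tuple nat) : (forall k, (tnth i k <= N)%N) ->
  exists j, i = val_tuple j.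
Proof.
move=> iN; exists [tuple inord (tnth i k) | k < n].
apply: eq_from_tnth => k; rewrite tnth_map tnth_mktuple/= inordK// ltnS.
exact: iN.
Qed.

Lemma fsbig_truncate (A : set (n.-tuple nat)) (F : n.-tuple nat -> R) :
  (forall i, A i -> F i != 0 -> forall k, (tnth i k <= N)%N) ->
  \sum_(i \in A) F i =
  \sum_(i : n.-tuple I | val_tuple i \in A) F (val_tuple i).
Proof.
move=> AN; have ur : uniq (map val_tuple (index_enum (n.-tuple I))).
  by rewrite (map_inj_uniq val_tuple_inj) index_enum_uniq.
rewrite -[in LHS](set_mem_set A) -(bigfs _ ur) ?big_map// => i /set_mem Ai.
apply: contraNeq => Fi; have [j ->] := val_tuple_surj (AN i Ai Fi).
by rewrite map_f// mem_index_enum.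
Qed.

Variables (p : R) (w : nat -> R) (a : n.-tuple nat -> R).
Hypotheses (p0 : 0 < p)
  (aN : forall i, a i != 0 -> forall k, (tnth i k <= N)%N).

Definition truncated (i : n.-tuple I) : unit -> R := fun _ => a (val_tuple i).

(** The outer sum is finite too: if the inner sum at [j] does not vanish, then
    [j] agrees on [S] with some multi-index of the support, and it is 0
    elsewhere. *)
Lemma mixed_norm_truncate (b : n.-tuple bool) :
  mixed_norm p w a [set k | tnth b k] =
  mixed_power (p / 2) w truncated b `^ p^-1.
Proof.
set S := [set k | tnth b k]%SET.
have inS k : (k \in S) = tnth b k by rewrite inE.
congr powR; rewrite fsbig_truncate => [|j outj].
  apply: eq_big => [j|j _].
    apply/idP/forallP => [/set_mem h k|h].
      by apply/implyP => bk; apply/eqP/val_inj; have := h k;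
        rewrite inS tnth_map => /(_ bk).
    by apply/mem_set => k; rewrite inS tnth_map => bk;
      have /implyP/(_ bk)/eqP -> := h k.
  congr powR; rewrite fsbig_truncate => [|i _]; last first.
    rewrite mulf_eq0 negb_or sqrf_eq0 normr_eq0 => /andP[ai _].
    exact: aN.
  apply: eq_big => [i|i _].
    apply/idP/forallP => [/set_mem h k|h].
      by apply/implyP => bk; apply/eqP/val_inj; have := h k;
        rewrite inS !tnth_map => /(_ bk).
    by apply/mem_set => k; rewrite inS !tnth_map => bk;
      have /implyP/(_ bk)/eqP -> := h k.
  congr (_ * _).
    by rewrite /sqnorm (big_pred1 tt) ?real_normK ?num_real//; case.
  rewrite big_mkcond; apply: eq_bigr => k _.
  by rewrite finset.in_setC inS tnth_map; case: ifP; case: ifP.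
have p20 : p / 2 != 0 by rewrite mulf_neq0 ?invr_eq0 ?gt_eqF.
apply: contraNP => /existsNP[k /negP jkN].
rewrite fsbig1 ?powR0// => i ij.
apply/eqP; rewrite mulf_eq0 sqrf_eq0 normr_eq0; apply/orP; left.
apply: contraNT jkN => ai; have [kS|kS] := boolP (k \in S).
  by rewrite -(ij _ kS); exact: aN.
by rewrite (outj _ kS).
Qed.

Lemma tensor_sum_truncate d (T : measurableType d) (x : nat -> T -> R)
    (t : n.-tuple T) :
  tensor_sum x a t = vector_sum x truncated t tt.
Proof.
rewrite /tensor_sum fsbig_truncate => [|i _].
  by apply: eq_bigl => i; apply/mem_set.
by rewrite mulf_eq0 negb_or => /andP[ai _]; exact: aN.
Qed.

End truncation.

Lemma finite_support_bounded {R : realType} n (a : n.-tuple nat -> R) :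
  finite_set [set i | a i != 0] ->
  exists N, forall i, a i != 0 -> forall k, (tnth i k <= N)%N.
Proof.
move=> /finite_seqP[s sE].
exists (\max_(i <- s) \max_(k < n) tnth i k)%N => i ai k.
apply: (@leq_trans (\max_(k < n) tnth i k)%N); first exact: (leq_bigmax k).
apply: (@leq_bigmax_seq _ _ predT
  (fun i : n.-tuple nat => \max_(k < n) tnth i k)%N) => //.
by move/seteqP : sE => [+ _] => /(_ i); exact.
Qed.

(** * The tensor estimate *)

Section Lp_normalised.
Local Open Scope ereal_scope.
Context d (T : measurableType d) {R : realType} (P : probability T R).
Variables (p : R) (f : T -> R).
Hypotheses (p2 : (2 < p)%R) (fLp : f \in Lfun P p%:E).

Lemma Lfun_measurable : measurable_fun setT f.
Proof. by move: fLp; rewrite inE => /andP[/[!inE]]. Qed.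

Let p1E : 1 <= p%:E.
Proof. by rewrite lee_fin ltW// (lt_trans _ p2)// ltr1n. Qed.

Lemma Lfun_integrable1 : P.-integrable setT (EFin \o f).
Proof.
apply/Lfun1_integrable; apply: Lfun_subset fLp => //.
by rewrite fin_num_measure.
Qed.

Lemma integral_sqr_Lnorm :
  \int[P]_t (f t ^+ 2)%:E = (fine 'N[P]_2%:E[EFin \o f] ^+ 2)%:E.
Proof.
have fin2 : 'N[P]_2%:E[EFin \o f] \is a fin_num.
  have : f \in Lfun P 2%:E.
    apply: Lfun_subset fLp; rewrite ?fin_num_measure// ?lee_fin ?ler1n//.
    exact: ltW.
  by rewrite inE => /andP[_ /[!inE]] f2; rewrite ge0_fin_numE ?Lnorm_ge0.
have := @poweR_Lnorm _ _ _ P (EFin \o f) 2%R.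
rewrite pnatr_eq0 -{1}(fineK fin2) poweR_EFin => /(_ isT).
rewrite powR_mulrn ?fine_ge0 ?Lnorm_ge0// => ->.
by apply: eq_integral => t _ /=; rewrite powR_mulrn// real_normK ?num_real.
Qed.

Lemma integral_powR_Lnorm : 'N[P]_p%:E[EFin \o f] = 1 ->
  \int[P]_t ((f t ^+ 2) `^ (p / 2))%:E = 1.
Proof.
move=> f1; have pn0 : p != 0%R by rewrite gt_eqF// (lt_trans _ p2).
have := @poweR_Lnorm _ _ _ P (EFin \o f) p pn0; rewrite f1 poweR1r => ->.
apply: eq_integral => t _ /=.
rewrite -[(f t ^+ 2)%R]real_normK ?num_real// -powR_mulrn// -powRrM.
by congr (_ `^ _)%:E; field.
Qed.

End Lp_normalised.

Lemma max_mixed_norm_ge {R : realType} (p : R) w n (a : n.-tuple nat -> R) S :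
  mixed_norm p w a S <= max_mixed_norm p w a.
Proof. by rewrite /max_mixed_norm; exact: le_bigmax_cond. Qed.

Theorem proposition3p13 (R : realType) (p : R) (hp : 2 < p) (n : nat)
    (x : nat -> unit_interval R -> R)
    (xLp : forall i, x i \in Lfun (@lebesgue01 R) p%:E)
    (xindep : independent_sequence (@lebesgue01 R) x)
    (xmean : forall i, ('E_(@lebesgue01 R)[x i] = 0)%E)
    (xnorm : forall i, ('N[@lebesgue01 R]_p%:E[EFin \o x i] = 1)%E) :
  let w i := fine ('N[@lebesgue01 R]_2%:E[EFin \o x i])%E in
  exists K1 K2 : R, 0 < K1 /\ 0 < K2 /\
    forall a : n.-tuple nat -> R, finite_set [set i | a i != 0] ->
      let A := ('N[power_probability (@lebesgue01 R) n]_p%:E[EFin \o tensor_sum x a])%E in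
      let B := max_mixed_norm p w a in
      (A <= (K1 * B)%:E)%E /\ (B%:E <= K2%:E * A)%E.
Proof.
move=> w; have q1 : 1 < p / 2 by lra.
have p0 : 0 < p by lra.
have pn0 : p != 0 by rewrite gt_eqF.
pose P := @lebesgue01 R.
have mx i : measurable_fun setT (x i) := Lfun_measurable (xLp i).
have x_int i := Lfun_integrable1 hp (xLp i).
have x_mean i : (\int[P]_t (x i t)%:E = 0)%E by rewrite -(xmean i) unlock.
have x_sq i := integral_sqr_Lnorm hp (xLp i).
have x_pow i := integral_powR_Lnorm hp (xnorm i).
have [K K0 HK] := rosenthal q1 mx xindep x_mean x_sq x_pow x_int.
pose Kn := K ^+ n.
have Kn0 : 0 < Kn by exact: exprn_gt0.
exists ((Kn * 2 ^+ n) `^ p^-1), (Kn `^ p^-1).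
split; first by rewrite powR_gt0 ?mulr_gt0 ?exprn_gt0.
split; first by rewrite powR_gt0.
move=> a /finite_support_bounded[N aN] A B.
pose a' := @truncated R n N a.
have [up lo] := tensor_rosenthal (w := w) mx K0 HK a'.
rewrite -/Kn in up lo.
set Q := total_power _ _ a' in up lo.
have AE : A = (tensor_moment P (p / 2) x a' `^ p^-1)%E.
  rewrite /A unlock; congr (_ `^ _)%E; apply: eq_integral => t _ /=.
  rewrite (tensor_sum_truncate aN).
  congr EFin.
  rewrite /sqnorm (big_pred1 tt); last by case.
  rewrite -[_ ^+ 2]real_normK ?num_real// -powR_mulrn// -powRrM.
  by congr (_ `^ _); field.
have tm_fin : tensor_moment P (p / 2) x a' \is a fin_num.
  by rewrite ge0_fin_numE ?tensor_moment_ge0// (le_lt_trans up)// ltry.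
rewrite -(fineK tm_fin) poweR_EFin in AE; rewrite AE {A AE}.
rewrite -(fineK tm_fin) ?lee_fin in up lo.
have m0 : 0 <= fine (tensor_moment P (p / 2) x a').
  by rewrite fine_ge0// tensor_moment_ge0.
move: (fine _) m0 up lo => m m0; rewrite -EFinM !lee_fin => up lo.
have mixed0 b : 0 <= mixed_power (p / 2) w a' b.
  by apply: sumr_ge0 => j _; exact: powR_ge0.
have normE b := mixed_norm_truncate w p0 aN b.
have pV0 : 0 <= p^-1 by rewrite invr_ge0 ltW.
have B0 : 0 <= B.
  exact: le_trans (powR_ge0 _ _) (max_mixed_norm_ge p w a finset.set0).
have mixed_le b : mixed_power (p / 2) w a' b <= B `^ p.
  have -> : mixed_power (p / 2) w a' b =
      mixed_norm p w a [set k | tnth b k] `^ p.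
    by rewrite normE -powRrM mulVf// powRr1.
  apply: ge0_ler_powR; rewrite ?nnegrE ?powR_ge0 ?(ltW p0)//.
  exact: max_mixed_norm_ge.
split.
  (* The sum over the 2 ^ n subsets is at most 2 ^ n times its largest term. *)
  rewrite (_ : _ * B = (Kn * 2 ^+ n * B `^ p) `^ p^-1); last first.
    rewrite [RHS]powRM ?powR_ge0 ?mulr_ge0 ?exprn_ge0 ?(ltW K0)//.
    by rewrite -[in RHS]powRrM divff// powRr1.
  apply: ge0_ler_powR;
    rewrite ?nnegrE ?mulr_ge0 ?exprn_ge0 ?powR_ge0 ?(ltW K0)//.
  apply: le_trans up _; rewrite -mulrA ler_pM2l// /Q /total_power.
  apply: le_trans (ler_sum _ (fun b _ => mixed_le b)) _.
  by rewrite sumr_const card_tuple card_bool -natrX mulr_natl.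
rewrite -powRM ?(ltW Kn0)//.
apply: bigmax_le => [|S _]; first exact: powR_ge0.
pose b := [tuple k \in S | k < n].
rewrite (_ : S = [set k | tnth b k]%SET); last first.
  by apply/setP => k; rewrite inE tnth_mktuple.
rewrite normE; apply: ge0_ler_powR; rewrite ?nnegrE ?mulr_ge0 ?(ltW Kn0)//.
apply: le_trans lo; rewrite /Q /total_power (bigD1 b)//= lerDl.
by apply: sumr_ge0 => b' _.
Qed.
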